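(* Let $S\subseteq\mathbb{Z}^+$. Then $$\sum_{n\ge 0}|\mathrm{UPF}^{\mathrm{T1}}_{n,S}|\frac{x^n}{n!}=\sum_{k\in S}(e^x-1)^k$$ as formal power series.
   Context: A parking preference $(a_1,\dots,a_n)\in[n]^n$ describes $n$ cars entering a one-way street with spots $1,\dots,n$ in the order $1,2,\dots,n$; car $i$ parks in the first unoccupied spot numbered $\ge a_i$. It is a parking function if all cars park. It is a unit interval parking function if it is a parking function and every car $i$ parks in spot $a_i$ or spot $a_i+1$. Car $i$ is lucky if it parks in spot $a_i$. $\mathrm{UPF}^{\mathrm{T1}}_{n,S}$ is the set of unit interval parking functions of length $n$ whose number of lucky cars belongs to $S$. For $n=0$, the only unit interval parking function is the empty tuple. It has $0$ lucky cars, so $|\mathrm{UPF}^{\mathrm{T1}}_{0,S}|=0$ when $S\subseteq\mathbb{Z}^+$. *)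

(* Defs.v *)
From HB Require Import structures.
From mathcomp Require Import all_boot all_order all_algebra.
From mathcomp Require Import boolp classical_sets functions cardinality fsbigop.

Set Implicit Arguments.
Unset Strict Implicit.
Unset Printing Implicit Defensive.

Import GRing.Theory.
Local Open Scope ring_scope.

(* Cars and spots are indexed from 0: the ordinal j : 'I_n stands for spot
   (or car) j + 1, and the tuple p for the preference (p_0 + 1, ..). *)

Section Parking.
Variable n : nat.
Implicit Types (occ : seq 'I_n) (p : n.-tuple 'I_n) (i : 'I_n).

(* [enum 'I_n] is increasing, so the head of the filtered list is the first
   free spot; None means that the car leaves the street without parking. *)
Definition first_free occ (a : 'I_n) : option 'I_n :=
  ohead [seq s : 'I_n <- enum 'I_n | (a <= s)%N && (s \notin occ)].

Fixpoint park_from occ (prefs : seq 'I_n) : seq (option 'I_n) :=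
  if prefs is a :: prefs' then
    let o := first_free occ a in
    o :: park_from (if o is Some s then s :: occ else occ) prefs'
  else [::].

Definition spot_of p i : option 'I_n := nth None (park_from [::] p) i.

Definition parking_function p : bool := [forall i, isSome (spot_of p i)].

Definition unit_interval_pf p : bool :=
  parking_function p &&
  [forall i, exists s : 'I_n, (spot_of p i == Some s) &&
     ((s == tnth p i :> nat) || (s == (tnth p i).+1 :> nat))].

Definition lucky p i : bool := spot_of p i == Some (tnth p i).

Definition nb_lucky p : nat := #|[pred i | lucky p i]|.

End Parking.

Definition UPF_T1 (n : nat) (S : set nat) : {set n.-tuple 'I_n} :=
  [set p : n.-tuple 'I_n | unit_interval_pf p && (nb_lucky p \in S)]%SET.

(* Formal power series over the rationals, given by their coefficients. The
   product is the Cauchy product, not the pointwise product of functions. *)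
Definition fps : Type := nat -> rat.

Definition fps_one : fps := fun n => (n == 0%N)%:R.

Definition fps_sub (f g : fps) : fps := fun n => f n - g n.

Definition fps_mul (f g : fps) : fps :=
  fun n => \sum_(i < n.+1) f i * g (n - i)%N.

Definition fps_pow (f : fps) (k : nat) : fps := iter k (fps_mul f) fps_one.

Definition fps_expx : fps := fun n => (n`!%:R)^-1.

Definition egf (c : nat -> nat) : fps := fun n => (c n)%:R / n`!%:R.

(* A family is summable when each coefficient is nonzero in only finitely many
   members. Without summability, fps_sum takes the default value 0 at the
   coefficients with infinitely many nonzero contributions. *)
Definition fps_summable (S : set nat) (F : nat -> fps) : Prop :=
  forall n, finite_set [set k | S k /\ F k n <> 0]%classic.

Definition fps_sum (S : set nat) (F : nat -> fps) : fps :=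
  fun n => \sum_(k \in S) F k n.

(* Main.v *)
Require Import Defs.
From HB Require Import structures.
From mathcomp Require Import all_boot all_order all_algebra.
From mathcomp Require Import boolp classical_sets functions cardinality fsbigop.
From mathcomp Require Import fintype finset zify.

Set Implicit Arguments.
Unset Strict Implicit.
Unset Printing Implicit Defensive.

Import Order.TTheory GRing.Theory Num.Theory.

(** A unit interval parking function is determined by its outcome (the
    permutation sending a car to its spot) and by the set of lucky cars; the
    only constraint is that an unlucky car parks right after the spot of an
    earlier car. Cutting the street before each lucky car therefore yields
    blocks inside which the cars are parked in order of arrival, so that unit
    interval parking functions of length [n] with [k] lucky cars correspond to
    surjections from cars to [k] blocks, i.e. to words of length [n] using all
    letters of a [k]-letter alphabet; the outcome is the standardization of the
    word. The numbers of such words satisfy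
    [w (n+1) k = k (w n k + w n (k-1))], by removing the first letter. With
    [E = e^x - 1] this is the coefficient form of
    [(E^k)' = k (E^k + E^(k-1))]. *)

Lemma sorted_ohead_filterP (T : eqType) (r : rel T) (P : pred T) (s : seq T) x :
    transitive r -> irreflexive r -> sorted r s ->
  ohead (filter P s) = Some x <->
  [/\ x \in s, P x & forall y, y \in s -> r y x -> ~~ P y].
Proof.
move=> r_tr r_irr; elim: s => [|z s IHs] /=; first by split=> // -[].
rewrite path_sortedE// => /andP[/allP z_min /IHs{}IHs].
have [Pz|nPz] := boolP (P z); split => /=.
- case=> <-; split=> //; first exact: mem_head.
  move=> y; rewrite inE => /predU1P[-> | /z_min zy yz]; first by rewrite r_irr.
  by have := r_tr _ _ _ zy yz; rewrite r_irr.
- case; rewrite inE => /predU1P[-> // | /z_min zx] _ /(_ z (mem_head _ _) zx).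
  by rewrite Pz.
- move/IHs=> [xs Px x_min]; split=> //; first by rewrite inE xs orbT.
  by move=> y; rewrite inE => /predU1P[-> // | /x_min].
- rewrite inE => -[/predU1P[-> | xs] Px x_min]; first by rewrite Px in nPz.
  by apply/IHs; split=> // y ys; apply: x_min; rewrite inE ys orbT.
Qed.

Lemma first_freeP n (occ : seq 'I_n) (a s : 'I_n) :
  first_free occ a = Some s <->
  [/\ a <= s, s \notin occ & forall t : 'I_n, a <= t < s -> t \in occ].
Proof.
pose lt_spot : rel 'I_n := fun i j => i < j.
have lt_sorted : sorted lt_spot (enum 'I_n).
  by have := iota_ltn_sorted 0 n; rewrite -val_enum_ord sorted_map.
have lt_trans : transitive lt_spot by move=> j i k; apply: ltn_trans.
have lt_irr : irreflexive lt_spot by move=> i; apply: ltnn.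
rewrite /first_free (sorted_ohead_filterP _ _ lt_trans lt_irr lt_sorted).
split=> [[_ /andP[le_as free_s] s_min]|[le_as free_s s_min]]; split=> //.
- move=> t /andP[le_at lt_ts].
  by have := s_min t (mem_enum _ _) lt_ts; rewrite le_at /= negbK.
- exact: mem_enum.
- exact/andP.
- move=> t _ lt_ts; apply/negP => /andP[le_at].
  by apply/negP; rewrite negbK s_min// le_at.
Qed.

Section Outcome.
Variable n : nat.
Implicit Types (occ : seq 'I_n) (p : n.-tuple 'I_n) (i j s t : 'I_n).

Lemma size_park_from occ prefs : size (park_from occ prefs) = size prefs.
Proof. by elim: prefs occ => //= a prefs IH occ; rewrite IH. Qed.

Lemma nth_park_from occ prefs a0 k : k < size prefs ->
  nth None (park_from occ prefs) k =
  first_free (catrev (pmap id (take k (park_from occ prefs))) occ)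
             (nth a0 prefs k).
Proof.
elim: prefs occ k => //= a prefs IH occ [|k] //= lt_k.
by rewrite IH//; case: (first_free occ a).
Qed.

Lemma spot_ofP p i s : spot_of p i = Some s <->
  [/\ tnth p i <= s, forall j, j < i -> spot_of p j <> Some s
    & forall t, tnth p i <= t < s ->
        exists2 j : 'I_n, j < i & spot_of p j = Some t].
Proof.
rewrite {1}/spot_of (nth_park_from _ i) ?size_tuple// -tnth_nth.
set occ := catrev _ _.
have occP t : t \in occ <-> exists2 j : 'I_n, j < i & spot_of p j = Some t.
  rewrite /occ catrevE cats0 mem_rev mem_pmap map_id; split.
    move=> /(nthP None)[k]; rewrite size_take size_park_from size_tuple ltn_ord.
    move=> lt_ki; rewrite nth_take// => nthk.
    by exists (Ordinal (ltn_trans lt_ki (ltn_ord i))).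
  move=> [j lt_ji <-]; rewrite /spot_of -(nth_take None lt_ji).
  by rewrite mem_nth// size_take size_park_from size_tuple ltn_ord.
rewrite first_freeP; split=> -[le_ps free_s s_min]; split=> //.
- by move=> j lt_ji pj; move/negP: free_s; apply; apply/occP; exists j.
- by move=> t /s_min/occP.
- by apply/negP => /occP[j lt_ji]; apply: free_s.
- by move=> t /s_min/occP.
Qed.

Definition unit_outcome p (sigma : 'I_n -> 'I_n) : Prop :=
  injective sigma /\
  forall i, sigma i = tnth p i \/
    (sigma i = (tnth p i).+1 :> nat /\
     exists2 j : 'I_n, j < i & sigma j = tnth p i).

Lemma unit_outcome_spot p sigma : unit_outcome p sigma ->
  forall i, spot_of p i = Some (sigma i).
Proof.
move=> [sigma_inj sigma_unit] i.
have [m] := ubnP i; elim: m i => // m IH i le_im.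
have IHi j : j < i -> spot_of p j = Some (sigma j).
  by move=> lt_ji; apply: IH; apply: leq_trans lt_ji le_im.
apply/spot_ofP; split.
- by case: (sigma_unit i) => [->|[-> _]].
- move=> j lt_ji; rewrite IHi// => -[/sigma_inj ji].
  by rewrite ji ltnn in lt_ji.
- move=> t /andP[le_pt lt_ts]; case: (sigma_unit i) => [si|[si [j lt_ji sj]]].
    by rewrite si ltnNge le_pt in lt_ts.
  exists j => //; rewrite IHi// sj; congr Some; apply: val_inj.
  by apply/eqP; rewrite eqn_leq le_pt -ltnS -si.
Qed.

Lemma spot_of_inj p i j s :
  spot_of p i = Some s -> spot_of p j = Some s -> i = j.
Proof.
wlog lt_ij : i j / i < j => [wlog_lt pi pj|pi /spot_ofP[_ /(_ i lt_ij)]//].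
case: (ltngtP i j) => [lt_ij|lt_ji|]; last exact: val_inj.
  exact: (wlog_lt _ _ lt_ij).
by rewrite (wlog_lt _ _ lt_ji).
Qed.

Lemma unit_interval_pfP p :
  unit_interval_pf p <-> exists sigma, unit_outcome p sigma.
Proof.
split=> [/andP[_ /forallP unit_p] | [sigma out]]; last first.
  have spot := unit_outcome_spot out.
  apply/andP; split; apply/forallP => i; first by rewrite spot.
  apply/existsP; exists (sigma i); rewrite spot eqxx /=.
  by case: (out.2 i) => [-> | [-> _]]; rewrite eqxx ?orbT.
pose sigma i := odflt i (spot_of p i).
have spot i : spot_of p i = Some (sigma i).
  by rewrite /sigma; have /existsP[s /andP[/eqP-> _]] := unit_p i.
exists sigma; split=> [i j eq_ij | i].
  by apply: (spot_of_inj (spot i)); rewrite eq_ij.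
have /existsP[s /andP[/eqP]] := unit_p i; rewrite spot => -[<-].
case/orP=> /eqP si; [by left; apply: val_inj | right; split=> //].
have /spot_ofP[_ _ /(_ (tnth p i))] := spot i.
rewrite si leqnn ltnSn => /(_ isT)[j lt_ji]; rewrite spot => -[<-].
by exists j.
Qed.

Lemma unit_outcome_lucky p sigma : unit_outcome p sigma ->
  forall i, lucky p i = (sigma i == tnth p i).
Proof. by move=> out i; rewrite /lucky (unit_outcome_spot out). Qed.

Lemma unit_outcome_pref p sigma : unit_outcome p sigma ->
  forall i, tnth p i = sigma i - ~~ lucky p i :> nat.
Proof.
move=> out i; rewrite (unit_outcome_lucky out).
have [-> | neq] := eqVneq (sigma i) (tnth p i); first by rewrite subn0.
case: (out.2 i) => [eq|[-> _]]; first by rewrite eq eqxx in neq.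
by rewrite subn1.
Qed.

Lemma nb_lucky_le p : nb_lucky p <= n.
Proof. by rewrite -[leqRHS]card_ord; apply: max_card. Qed.

End Outcome.

Section Blocks.
Variables (n : nat) (p : n.-tuple 'I_n) (sigma : 'I_n -> 'I_n).
Implicit Types i j : 'I_n.

(* The blocks are numbered from 1 along the street. *)
Definition block i : nat := #|[set j | lucky p j & sigma j <= sigma i]|.

Lemma leq_block i j : sigma i <= sigma j -> block i <= block j.
Proof.
move=> le_ij; apply/subset_leq_card/subsetP => l; rewrite !inE => /andP[-> /=].
by move=> /leq_trans; apply.
Qed.

Lemma ltn_block i j : lucky p j -> sigma i < sigma j -> block i < block j.
Proof.
move=> lucky_j lt_ij; apply/proper_card/properP; split.
  apply/subsetP => l; rewrite !inE => /andP[-> /=] le_l.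
  exact: leq_trans le_l (ltnW lt_ij).
by exists j; rewrite !inE lucky_j /= ?leqnn// -ltnNge.
Qed.

Lemma block_le_nb_lucky i : block i <= nb_lucky p.
Proof. by apply/subset_leq_card/subsetP => l; rewrite !inE => /andP[]. Qed.

Hypothesis out : unit_outcome p sigma.

Lemma unlucky_prev i : ~~ lucky p i ->
  exists2 j : 'I_n, j < i & sigma i = (sigma j).+1 :> nat.
Proof.
rewrite (unit_outcome_lucky out) => unlucky_i.
case: (out.2 i) => [si|[si [j lt_ji sj]]].
  by rewrite si eqxx in unlucky_i.
by exists j; rewrite // si sj.
Qed.

Lemma block_unlucky i j : ~~ lucky p i -> sigma i = (sigma j).+1 :> nat ->
  block i = block j.
Proof.
move=> unlucky_i sij; apply: eq_card => l; rewrite !inE sij.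
apply/andb_id2l => lucky_l; rewrite leq_eqVlt ltnS -sij val_eqE (inj_eq out.1).
by case: eqP => // li; rewrite -li lucky_l in unlucky_i.
Qed.

Lemma block_gt0 i : 0 < block i.
Proof.
have [m] := ubnP (sigma i); elim: m i => // m IH i le_m.
have [lucky_i|unlucky_i] := boolP (lucky p i).
  by apply/card_gt0P; exists i; rewrite inE lucky_i leqnn.
have [j _ sij] := unlucky_prev unlucky_i.
by rewrite (block_unlucky unlucky_i sij) IH// -ltnS -sij.
Qed.

(* Between two cars of the same block all cars are unlucky, and an unlucky car
   arrives after the car parked just before it. *)
Lemma ltn_same_block i j : sigma i < sigma j -> block i = block j -> i < j.
Proof.
have [m] := ubnP (sigma j); elim: m j => // m IH j le_m lt_ij eq_ij.
have [lucky_j|unlucky_j] := boolP (lucky p j).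
  by have := ltn_block lucky_j lt_ij; rewrite eq_ij ltnn.
have [l lt_lj sjl] := unlucky_prev unlucky_j.
move: lt_ij; rewrite sjl ltnS leq_eqVlt => /predU1P[/val_inj/out.1-> //|lt_il].
apply: ltn_trans lt_lj; apply: IH => //; first by rewrite -ltnS -sjl.
by rewrite eq_ij (block_unlucky unlucky_j sjl).
Qed.

End Blocks.

Section Rank.
Context {d : Order.disp_t} {T : finType} {O : orderType d}.
Variable key : T -> O.
Implicit Types x y : T.

Definition rank x : nat := #|[set y | (key y < key x)%O]|.

Lemma ltn_rank_card x : rank x < #|T|.
Proof.
rewrite -cardsT; apply: proper_card; apply/properP.
by split; [apply: subsetT | exists x; rewrite // inE ltxx].
Qed.

Lemma ltn_rank x y : (rank x < rank y) = (key x < key y)%O.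
Proof.
case: ltP => [lt_xy|le_yx]; last first.
  apply/negbTE; rewrite -leqNgt; apply/subset_leq_card/subsetP => z.
  by rewrite !inE => /lt_le_trans; apply.
apply: proper_card; apply/properP; split.
  by apply/subsetP => z; rewrite !inE => /lt_trans; apply.
by exists x; rewrite !inE ?ltxx.
Qed.

Hypothesis key_inj : injective key.

Lemma rank_inj : injective rank.
Proof.
move=> x y eq_xy; apply/key_inj/eqP.
by case: ltgtP => //; rewrite -ltn_rank eq_xy ltnn.
Qed.

Lemma card_key_le x : #|[set y | (key y <= key x)%O]| = (rank x).+1.
Proof.
rewrite (cardsD1 x) inE lexx add1n; congr _.+1.
by apply: eq_card => y; rewrite !inE lt_neqAle (inj_eq key_inj).
Qed.

Lemma rank_succ x y : (key y < key x)%O ->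
  (forall z, (key z < key x)%O -> (key z <= key y)%O) -> rank x = (rank y).+1.
Proof.
move=> lt_yx y_max; rewrite -card_key_le; apply: eq_card => z; rewrite !inE.
by apply/idP/idP => [/y_max//|/le_lt_trans]; apply.
Qed.

End Rank.

Lemma card_ord_ltn n (i : 'I_n) : #|[set j : 'I_n | j < i]| = i.
Proof.
rewrite cardsE -sum1_card -(big_ord_widen n (fun=> 1)) ?(ltnW (ltn_ord i))//.
by rewrite sum1_card card_ord.
Qed.

Lemma rank_bij (d : Order.disp_t) (T : finType) (O : orderType d) n
    (key : T -> O) (sigma : T -> 'I_n) :
    bijective sigma -> (forall x y, sigma x < sigma y -> (key x < key y)%O) ->
  forall x, rank key x = sigma x.
Proof.
move=> sigma_bij lt_key x; rewrite -(card_ord_ltn (sigma x)).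
rewrite -(on_card_preimset (onW_bij _ sigma_bij)); apply: eq_card => y.
rewrite !inE; apply/idP/idP => [|/lt_key//].
case: (ltngtP (sigma y) (sigma x)) => // [/lt_key/lt_gtF->//|].
by move/val_inj/(bij_inj sigma_bij)->; rewrite ltxx.
Qed.

Section FirstOccurrences.
Context {T : eqType} {n : nat}.
Variable f : n.-tuple T.
Implicit Types i j : 'I_n.

Definition first_occ i : bool :=
  [forall j, (tnth f j == tnth f i) ==> (i <= j)].

Lemma first_occP i :
  reflect (forall j, tnth f j = tnth f i -> i <= j) (first_occ i).
Proof.
apply: (iffP forallP) => i_first j; last by apply/implyP => /eqP /i_first.
by move=> /eqP; apply/implyP.
Qed.

Lemma first_occ_inj : {in first_occ &, injective (tnth f)}.
Proof.
move=> i j /first_occP i_first /first_occP j_first fij.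
by apply: val_inj; apply/eqP; rewrite eqn_leq i_first ?j_first.
Qed.

Lemma exists_first_occ x : x \in f -> exists2 j, first_occ j & tnth f j = x.
Proof.
case/tnthP=> i ->.
have [|j /eqP fji j_min] :=
  @arg_minnP _ i [pred j | tnth f j == tnth f i] (@nat_of_ord n).
  by rewrite /= eqxx.
by exists j => //; apply/first_occP => l flj; apply: j_min; rewrite /= flj fji.
Qed.

End FirstOccurrences.

Section Standardization.
Context {d : Order.disp_t} {T : orderType d} {n : nat}.
Variable f : n.-tuple T.
Implicit Types i j : 'I_n.

Definition std_key i : T *lexi[d] 'I_n := (tnth f i, i).

Lemma std_key_inj : injective std_key.
Proof. by move=> i j []. Qed.

Lemma std_key_lt i j : (std_key i < std_key j)%O =
  (tnth f i <= tnth f j)%O && ((tnth f j <= tnth f i)%O ==> (i < j)).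
Proof. by rewrite ltxi_pair ltEord. Qed.

Lemma std_rank_subproof i : rank std_key i < n.
Proof. by rewrite -[X in _ < X]card_ord ltn_rank_card. Qed.

Definition std i : 'I_n := Ordinal (std_rank_subproof i).

Lemma std_inj : injective std.
Proof. by move=> i j /(congr1 val)/(rank_inj std_key_inj). Qed.

Lemma std_not_first_occ i : ~~ first_occ f i ->
  exists2 j : 'I_n, j < i & std i = (std j).+1 :> nat.
Proof.
(* [j] is the last car before [i] with the letter of [i]. *)
rewrite negb_forall => /existsP[j0]; rewrite negb_imply -ltnNge => j0P.
have [//|j /andP[/eqP fj lt_ji] j_max] :=
  @arg_maxnP _ j0 [pred j : 'I_n | (tnth f j == tnth f i) && (j < i)]
    (@nat_of_ord n).
exists j => //; apply: (rank_succ std_key_inj) => [|l].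
  by rewrite std_key_lt fj lexx.
rewrite !leNgt !std_key_lt fj => /andP[le_li]; apply: contraTN => /andP[le_il].
rewrite le_li le_il /= -leqNgt => lt_jl; rewrite leqNgt; apply/negP => lt_li.
by have := j_max l; rewrite /= eq_le le_li le_il lt_li leqNgt lt_jl => /(_ isT).
Qed.

(* The truth value [~~ first_occ f i] is read as 0 or 1: only the first car of a
   block prefers the spot where it parks, the others the spot before. *)
Lemma word_pref_subproof i : std i - ~~ first_occ f i < n.
Proof. exact: leq_ltn_trans (leq_subr _ _) (ltn_ord _). Qed.

Definition word_upf : n.-tuple 'I_n :=
  [tuple Ordinal (word_pref_subproof i) | i < n].

Lemma val_word_upf i : tnth word_upf i = std i - ~~ first_occ f i :> nat.
Proof. by rewrite tnth_mktuple. Qed.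

Lemma word_upf_outcome : unit_outcome word_upf std.
Proof.
split=> [|i]; first exact: std_inj.
have := val_word_upf i; case: (boolP (first_occ f i)) => [_|].
  by rewrite subn0; left; apply: val_inj.
case/std_not_first_occ=> j lt_ji ->; rewrite subn1 /= => pref_i.
by right; split; [rewrite pref_i | exists j => //; apply: val_inj].
Qed.

Lemma lucky_word_upf : lucky word_upf =1 first_occ f.
Proof.
move=> i; rewrite (unit_outcome_lucky word_upf_outcome).
rewrite -[LHS]/(std i == tnth word_upf i :> nat) val_word_upf.
case: (boolP (first_occ f i)) => [_|/std_not_first_occ[j _ ->]].
  by rewrite subn0 eqxx.
by rewrite subn1 gtn_eqF.
Qed.

Lemma std_le_first_occ i j : first_occ f j ->
  (std j <= std i) = (tnth f j <= tnth f i)%O.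
Proof.
move=> /first_occP j_first; rewrite leqNgt ltn_rank std_key_lt.
by case: ltgtP => // fij; rewrite -leqNgt j_first.
Qed.

End Standardization.

Section Words.
Variable T : finType.
Implicit Types A B : {set T}.

Definition words_onto n A : {set n.-tuple T} :=
  [set t : n.-tuple T | [set x in t] == A].

Lemma words_onto_setT n (t : n.-tuple T) :
  reflect (forall x, x \in t) (t \in words_onto n [set: T]).
Proof.
rewrite inE -subTset; apply: (iffP subsetP) => [onto x|onto x _].
  by have := onto x (in_setT x); rewrite inE.
by rewrite inE.
Qed.

Lemma setU1_eq x A B :
  (x |: B == A) = (x \in A) && ((B == A) || (B == A :\ x)).
Proof.
apply/eqP/andP => [<-|[xA /orP[]/eqP->]]; last exact: setD1K.
  rewrite setU11; split=> //; have [xB|xB] := boolP (x \in B).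
    by rewrite [in X in X || _](setUidPr _) ?sub1set// eqxx.
  by rewrite setU1K// eqxx orbT.
by apply/setUidPr; rewrite sub1set.
Qed.

Lemma card_words_onto0 A : #|words_onto 0 A| = (A == set0).
Proof.
have -> : words_onto 0 A = [set t : 0.-tuple T | A == set0].
  by apply/setP => t; rewrite !inE tuple0 set_nil eq_sym.
by case: eqP => _; rewrite ?cards0// cardsT card_tuple expn0.
Qed.

Lemma card_words_ontoS n A :
  #|words_onto n.+1 A| =
  \sum_(x in A) (#|words_onto n A| + #|words_onto n (A :\ x)|).
Proof.
have card_eq m B :
    #|words_onto m B| = \sum_(t : m.-tuple T) ([set x in t] == B).
  rewrite -sum1_card big_mkcond; apply: eq_bigr => t _.
  by rewrite inE; case: eqP.
pose cons_tuple (u : T * n.-tuple T) := [tuple of u.1 :: u.2].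
have cons_tuple_bij : bijective cons_tuple.
  exists (fun t : n.+1.-tuple T => (thead t, [tuple of behead t])) => [[x t]|t].
    by congr (_, _); apply: val_inj.
  by rewrite [RHS]tuple_eta; apply: val_inj.
rewrite card_eq (reindex cons_tuple) /=; last exact: onW_bij.
rewrite -(pair_bigA _ (fun x (t : n.-tuple T) =>
  ([set y in x :: t] == A : nat))) /= [RHS]big_mkcond.
apply: eq_bigr => x _; rewrite !card_eq -big_split /=.
under eq_bigr do rewrite set_cons setU1_eq.
case: ifPn => [xA|_]; last by rewrite big1.
apply: eq_bigr => t _ /=; case: eqP => [->|_] //=.
by case: eqP => // eq_A; rewrite eq_A setD11 in xA.
Qed.

End Words.

Lemma card_first_occ (T : finType) n (f : n.-tuple T) (A : {set T}) :
  f \in words_onto n [set: T] ->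
  #|[set i | first_occ f i & tnth f i \in A]| = #|A|.
Proof.
move=> /words_onto_setT f_onto.
rewrite -(@card_in_imset _ _ (tnth f)); last first.
  by move=> i j; rewrite !inE => /andP[+ _] /andP[+ _]; apply: first_occ_inj.
apply: eq_card => x; apply/imsetP/idP => [[i]|xA].
  by rewrite inE => /andP[_ ?] ->.
have [i i_first fi] := exists_first_occ (f_onto x).
by exists i; rewrite ?inE ?i_first ?fi.
Qed.

Section WordToParking.
Context {d : Order.disp_t} {T : finOrderType d} {n : nat}.
Implicit Type f : n.-tuple T.

Lemma nb_lucky_word_upf f : f \in words_onto n [set: T] ->
  nb_lucky (word_upf f) = #|T|.
Proof.
move=> f_onto; rewrite -cardsT -(card_first_occ [set: T] f_onto).
by apply: eq_card => j; rewrite !inE lucky_word_upf andbT.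
Qed.

Lemma block_word_upf f i : f \in words_onto n [set: T] ->
  block (word_upf f) (std f) i = (rank id (tnth f i)).+1.
Proof.
move=> f_onto; rewrite -card_key_le// -(card_first_occ _ f_onto).
apply: eq_card => j; rewrite !inE lucky_word_upf.
by apply/andb_id2l => /std_le_first_occ->.
Qed.

Lemma word_upf_inj : {in words_onto n [set: T] &, injective (@word_upf d T n)}.
Proof.
move=> f g f_onto g_onto eq_fg.
have eq_std i : std f i = std g i.
  apply: Some_inj; rewrite -(unit_outcome_spot (word_upf_outcome f)) eq_fg.
  exact: unit_outcome_spot (word_upf_outcome g) i.
apply: eq_from_tnth => i; apply: (@rank_inj _ _ _ id) => //; apply/succn_inj.
rewrite -!block_word_upf// eq_fg; apply: eq_card => j.
by rewrite !inE !eq_std.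
Qed.

End WordToParking.

Section ParkingToWord.
Variables (n : nat) (p : n.-tuple 'I_n) (sigma : 'I_n -> 'I_n).
Hypothesis out : unit_outcome p sigma.
Implicit Types i j : 'I_n.

Lemma block_word_subproof i : (block p sigma i).-1 < nb_lucky p.
Proof. by rewrite prednK ?(block_gt0 out) ?block_le_nb_lucky. Qed.

Definition block_word : n.-tuple 'I_(nb_lucky p) :=
  [tuple Ordinal (block_word_subproof i) | i < n].

Lemma val_block_word i : tnth block_word i = (block p sigma i).-1 :> nat.
Proof. by rewrite tnth_mktuple. Qed.

Lemma block_word_eq i j :
  tnth block_word i = tnth block_word j <-> block p sigma i = block p sigma j.
Proof.
split=> [/(congr1 val)/(congr1 succn)|eq_ij]; last first.
  by apply: val_inj; rewrite /= !val_block_word eq_ij.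
by rewrite /= !val_block_word !prednK ?(block_gt0 out).
Qed.

Lemma first_occ_block_word : first_occ block_word =1 lucky p.
Proof.
move=> i; apply/first_occP/idP => [i_first|lucky_i j /block_word_eq eq_ji].
  apply/negPn/negP => unlucky_i.
  have [j lt_ji sij] := unlucky_prev out unlucky_i.
  have := i_first j; rewrite leqNgt lt_ji => /(_ _)/notF; apply.
  by apply/block_word_eq; rewrite (block_unlucky out unlucky_i sij).
case: (ltngtP (sigma i) (sigma j)) => [lt_ij|lt_ji|/val_inj/out.1->//].
  exact/ltnW/(ltn_same_block out lt_ij).
by have := ltn_block lucky_i lt_ji; rewrite eq_ji ltnn.
Qed.

Lemma std_block_word : std block_word =1 sigma.
Proof.
move=> i; apply: val_inj; apply: rank_bij (injF_bij out.1) _ i => i j lt_ij.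
have le_block := leq_block p (ltnW lt_ij).
rewrite std_key_lt !leEord !val_block_word -!subn1 leq_sub2r//=.
apply/implyP; rewrite leq_subLR subnKC ?(block_gt0 out)// => ge_block.
by apply: (ltn_same_block out) => //; apply/eqP; rewrite eqn_leq le_block.
Qed.

Lemma block_word_onto : block_word \in words_onto n [set: 'I_(nb_lucky p)].
Proof.
apply/words_onto_setT => x.
suff: x \in tnth block_word @: [set i | lucky p i].
  by case/imsetP => i _ ->; apply: mem_tnth.
rewrite (_ : _ @: _ = setT) ?inE//; apply/eqP.
rewrite eqEcard subsetT cardsT card_ord card_in_imset.
  by apply/subset_leq_card/subsetP => i; rewrite !inE.
by move=> i j; rewrite !inE -!first_occ_block_word; apply: first_occ_inj.
Qed.

Lemma word_upf_block_word : word_upf block_word = p.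
Proof.
apply: eq_from_tnth => i; apply: val_inj; rewrite /= val_word_upf.
by rewrite first_occ_block_word std_block_word (unit_outcome_pref out).
Qed.

End ParkingToWord.

Definition upf_lucky n k : {set n.-tuple 'I_n} :=
  [set p : n.-tuple 'I_n | unit_interval_pf p & nb_lucky p == k].

Lemma card_upf_lucky n k :
  #|upf_lucky n k| = #|words_onto n [set: 'I_k]|.
Proof.
rewrite -(card_in_imset (@word_upf_inj _ 'I_k n)); apply: eq_card => p.
rewrite inE; apply/andP/imsetP => [[/unit_interval_pfP[sigma out] /eqP <-]|].
  by exists (block_word out); rewrite ?block_word_onto ?word_upf_block_word.
case=> f f_onto ->; split; last by rewrite nb_lucky_word_upf ?card_ord.
by apply/unit_interval_pfP; exists (std f); apply: word_upf_outcome.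
Qed.

Lemma card_UPF_T1 n (S : set nat) :
  #|UPF_T1 n S| = \sum_(k < n.+1 | (k : nat) \in S) #|upf_lucky n k|.
Proof.
have lucky_lt (p : n.-tuple 'I_n) : nb_lucky p < n.+1.
  by rewrite ltnS nb_lucky_le.
rewrite -sum1_card (partition_big (fun p => Ordinal (lucky_lt p))
  (fun k : 'I_n.+1 => (k : nat) \in S)) /=; last first.
  by move=> p; rewrite inE => /andP[].
apply: eq_bigr => k kS; rewrite -sum1_card; apply: eq_bigl => p.
by rewrite !inE -val_eqE /=; case: eqP => [->|]; rewrite ?kS ?andbT ?andbF.
Qed.

Section Series.
Local Open Scope ring_scope.

Local Notation expx_sub1 := (fps_sub fps_expx fps_one).

(* Truncation to polynomials makes [deriv_exp] available for power series. *)
Lemma fps_pow_coef_poly f k m n : (n < m)%N ->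
  fps_pow f k n = ((\poly_(i < m) f i) ^+ k)`_n.
Proof.
elim: k n => [|k IH] n lt_nm; first by rewrite expr0 coef1.
rewrite exprS coefM; apply: eq_bigr => i _.
rewrite coef_poly (leq_ltn_trans (leq_ord i) lt_nm); congr (_ * _).
exact/IH/leq_ltn_trans/lt_nm/leq_subr.
Qed.

Lemma fps_pow_eq0 f k n : f 0%N = 0 -> (n < k)%N -> fps_pow f k n = 0.
Proof.
move=> f0; elim: k n => // k IH n lt_nk; apply: big1 => i _.
case: (posnP i) => [->|i_gt0]; first by rewrite f0 mul0r.
by rewrite [X in _ * X]IH ?mulr0//; move: lt_nk (ltn_ord i); lia.
Qed.

Lemma deriv_expx_sub1 n : expx_sub1 n.+1 *+ n.+1 = expx_sub1 n + fps_one n.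
Proof.
rewrite /fps_sub /fps_expx /fps_one /= subr0 subrK -[LHS]mulr_natl factS natrM.
by rewrite invfM mulVKf// pnatr_eq0.
Qed.

Lemma fps_pow_expx_sub1_rec k n :
  fps_pow expx_sub1 k n.+1 *+ n.+1 =
  (fps_pow expx_sub1 k n + fps_pow expx_sub1 k.-1 n) *+ k.
Proof.
case: k => [|k]; first by rewrite mulr0n /= /fps_one mul0rn.
rewrite !(@fps_pow_coef_poly _ _ n.+2)//=; set E := \poly_(i < _) _.
have coef_derivE i : (i <= n)%N -> E^`()`_i = (E + 1)`_i.
  move=> le_in; rewrite coef_deriv coefD coef1 !coef_poly !ltnS leqW// le_in.
  exact: deriv_expx_sub1.
rewrite -coef_deriv deriv_exp coefMn /= exprS -{3}[E ^+ k]mul1r -coefD -mulrDl.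
rewrite !coefM; congr (_ *+ _); apply: eq_bigr => i _.
by rewrite coef_derivE ?leq_ord.
Qed.

Lemma card_words_onto (T : finType) n (A : {set T}) :
  #|words_onto n A|%:R = n`!%:R * fps_pow expx_sub1 #|A| n :> rat.
Proof.
elim: n A => [|n IH] A.
  rewrite card_words_onto0 fact0 mul1r -cards_eq0.
  by case: posnP => [->|A_gt0] //; rewrite fps_pow_eq0.
rewrite card_words_ontoS natr_sum.
transitivity (\sum_(x in A) n`!%:R *
    (fps_pow expx_sub1 #|A| n + fps_pow expx_sub1 #|A|.-1 n) : rat).
  by apply: eq_bigr => x xA; rewrite natrD !IH mulrDr (cardsD1 x A) xA.
rewrite sumr_const -mulrnAr -fps_pow_expx_sub1_rec factS mulnC natrM -mulrA.
by rewrite [n.+1%:R * _]mulr_natl.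
Qed.

Lemma fps_pow_expx_sub1_egf k :
  fps_pow expx_sub1 k = egf (fun n => #|upf_lucky n k|).
Proof.
apply/funext => n; rewrite /egf card_upf_lucky card_words_onto cardsT card_ord.
by rewrite mulrAC divff ?mul1r// pnatr_eq0 -lt0n fact_gt0.
Qed.

Lemma fps_summable_trig (S : set nat) (F : nat -> fps) :
  (forall k n, (n < k)%N -> F k n = 0) -> fps_summable S F.
Proof.
move=> F0 n; apply: (@sub_finite_set _ _ `I_n.+1); last exact: finite_II.
by move=> k [_ /eqP]; rewrite /= ltnS leqNgt; apply: contra => /F0->.
Qed.

Lemma fps_sum_trig (S : set nat) (F : nat -> fps) n :
  (forall k n, (n < k)%N -> F k n = 0) ->
  fps_sum S F n = \sum_(k < n.+1 | (k : nat) \in S) F k n.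
Proof.
move=> F0; rewrite [RHS]big_mkcond.
rewrite (fsbig_ord _ _ (fun k => if k \in S then F k n else 0)).
rewrite -fsbig_mkcondr; apply/esym/fsbig_widen => [k []//|k [Sk]] /=.
by move=> /not_andP[|//] /negP; rewrite -leqNgt; apply: F0.
Qed.

End Series.

Theorem theorem3p6 (S : set nat) (S_pos : forall k : nat, S k -> (0 < k)%N) :
  fps_summable S (fps_pow (fps_sub fps_expx fps_one)) /\
  egf (fun n : nat => #|UPF_T1 n S|)
    = fps_sum S (fps_pow (fps_sub fps_expx fps_one)).
Proof.
have pow0 k n : n < k -> fps_pow (fps_sub fps_expx fps_one) k n = 0%R.
  by apply: fps_pow_eq0.
split; first exact: fps_summable_trig.
apply/funext => n; rewrite fps_sum_trig// /egf card_UPF_T1 natr_sum mulr_suml.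
by apply: eq_bigr => k _; rewrite fps_pow_expx_sub1_egf.
Qed.
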